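(* Let $\mathbb{K}$ be a field, let $d$ be a positive integer, and let $\mathcal{C}$ be a $d$-uniform decomposable clutter on the vertex set $[n]$. Then the ideal $I(\bar{\mathcal{C}})\subseteq S=\mathbb{K}[x_1,\ldots,x_n]$ has linear quotients.
   Context: A clutter $\mathcal{C}$ on a finite vertex set $V$ is a collection of subsets of $V$ (called circuits) none of which is contained in another; it is $d$-uniform if every circuit has exactly $d$ elements. Write $V(\mathcal{C})$ for its vertex set (which may contain vertices lying in no circuit). A subclutter is a subset of $\mathcal{C}$ (on the same vertex set). The complete $d$-uniform clutter $\mathcal{C}_{n,d}$ on a vertex set $V$ with $|V|=n$ is $\{F\subseteq V: |F|=d\}$; if $n<d$ it consists of $n$ isolated vertices and no circuits. For a $d$-uniform clutter $\mathcal{C}$ on $V$, its complement is $\bar{\mathcal{C}}=\{F\subseteq V: |F|=d,\ F\notin\mathcal{C}\}$. The circuit ideal of a clutter $\mathcal{C}$ on $[n]=\{1,\ldots,n\}$ is $I(\mathcal{C})=(\mathbf{x}_T: T\in\mathcal{C})\subseteq \mathbb{K}[x_1,\dots,x_n]$, where $\mathbf{x}_T=\prod_{i\in T}x_i$, and $I(\varnothing)=0$. A homogeneous ideal has linear quotients if it has an ordered set of minimal generators $u_1,\ldots,u_r$ such that the colon ideal $(u_1,\ldots,u_{i-1}):u_i$ is generated by linear forms for $i=2,\ldots,r$ (the zero ideal, with empty generating set, satisfies this vacuously). A subset $F\subseteq V$ is a clique in the $d$-uniform clutter $\mathcal{C}$ if either $|F|<d$ or all $d$-subsets of $F$ belong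 to $\mathcal{C}$. For a $(d-1)$-subset $e$ of $V$, let $N_{\mathcal{C}}[e]=e\cup\{c\in V: e\cup\{c\}\in\mathcal{C}\}$; $e$ is simplicial over $\mathcal{C}$ if $N_{\mathcal{C}}[e]$ is a clique in $\mathcal{C}$. The deletion of $e$ is $\mathcal{C}\setminus e=\{F\in\mathcal{C}: e\nsubseteq F\}$. For a sequence $\mathbf{e}=e_1,\ldots,e_t$ of $(d-1)$-subsets put $\mathcal{C}_{\mathbf{e}}^0=\mathcal{C}$ and $\mathcal{C}_{\mathbf{e}}^i=(\mathcal{C}\setminus e_1)\setminus\cdots\setminus e_i$. Simplicial subclutter: a subclutter $\mathcal{D}\subsetneq\mathcal{C}$ is a simplicial subclutter of $\mathcal{C}$ if there are $(d-1)$-subsets $\mathbf{e}=e_1,\ldots,e_t$ of $V$ and sets $A_i\subseteq\{F\in\mathcal{C}_{\mathbf{e}}^{i-1}: e_i\subset F\}$, $i=1,\ldots,t$, such that $e_1$ is simplicial over $\mathcal{C}$, $e_i$ is simplicial over $\mathcal{C}\setminus A_1\setminus\cdots\setminus A_{i-1}$ for $i>1$ (set difference), and $\mathcal{D}=\mathcal{C}\setminus A_1\setminus\cdots\setminus A_t$. Decomposable clutters: the class of $d$-uniform decomposable clutters is defined recursively by: (i) $\mathcal{C}_{n,d}$ is decomposable; (ii) if $\mathcal{D}=\mathcal{C}_1\cup\mathcal{C}_2$ (on vertex set $V(\mathcal{C}_1)\cup V(\mathcal{C}_2)$), where $\mathcal{C}_1,\mathcal{C}_2$ are $d$-uniform decomposable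 clutters on $V(\mathcal{C}_1),V(\mathcal{C}_2)$ with $V(\mathcal{C}_1)\nsubseteq V(\mathcal{C}_2)$, $V(\mathcal{C}_2)\nsubseteq V(\mathcal{C}_1)$ and $V(\mathcal{C}_1)\cap V(\mathcal{C}_2)$ a clique in both $\mathcal{C}_1$ and $\mathcal{C}_2$, then $\mathcal{D}$ is decomposable; (iii) every simplicial subclutter of a decomposable clutter is decomposable. *)

(* Defs.v *)
From HB Require Import structures.
From mathcomp Require Import all_boot all_order all_algebra.
From mathcomp Require Import mpoly.

Set Implicit Arguments.
Unset Strict Implicit.
Unset Printing Implicit Defensive.

Import GRing.Theory.
Local Open Scope ring_scope.

(* A clutter is given by a vertex set V inside an ambient finite type T        *)
(* together with its set C of circuits: V matters because it may contain       *)
(* vertices that lie in no circuit.                                            *)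
Section Clutters.

Variables (T : finType) (d : nat).
Implicit Types (V e F : {set T}) (C D : {set {set T}}).

Definition is_clutter V C : Prop :=
  (forall F, F \in C -> F \subset V) /\
  (forall F G, F \in C -> G \in C -> F \subset G -> F = G).

Definition uniform C : Prop := forall F, F \in C -> #|F| = d.

Definition complete_clutter V : {set {set T}} :=
  [set F : {set T} | (F \subset V) && (#|F| == d)].

Definition complement V C : {set {set T}} :=
  [set F : {set T} | [&& F \subset V, #|F| == d & F \notin C]].

Definition clique V C F : Prop :=
  F \subset V /\
  ((#|F| < d)%N \/ forall G : {set T}, G \subset F -> #|G| = d -> G \in C).

Definition closed_nbh V C e : {set T} :=
  e :|: [set c in V | (e :|: [set c]) \in C].

Definition simplicial V C e : Prop := clique V C (closed_nbh V C e).

Definition deletion C e : {set {set T}} := [set F in C | ~~ (e \subset F)].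

(* With 0-based indices, [take i] keeps the entries strictly before the i-th,  *)
(* so the inner foldl is the iterated deletion C_e^(i-1) and the outer ones    *)
(* are the iterated set differences C \ A_1 \ ... \ A_(i-1). The value d.-1 is *)
(* only meant for d > 0.                                                       *)
Definition simplicial_subclutter V C D : Prop :=
  D \proper C /\
  exists (t : nat) (e : t.-tuple {set T}) (A : t.-tuple {set {set T}}),
    [/\ forall i : 'I_t, tnth e i \subset V /\ #|tnth e i| = d.-1,
        forall i : 'I_t,
          tnth A i \subset
            [set F in foldl deletion C (take i e) | tnth e i \subset F],
        forall i : 'I_t,
          simplicial V (foldl (fun B X => B :\: X) C (take i A)) (tnth e i)
      & D = foldl (fun B X => B :\: X) C A].

(* Restricting to vertex sets inside T loses nothing: each rule builds a       *)
(* clutter from clutters whose vertex sets are contained in its own.           *)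
Inductive decomposable : {set T} -> {set {set T}} -> Prop :=
| Decomposable_complete V : decomposable V (complete_clutter V)
| Decomposable_union V1 C1 V2 C2 :
    decomposable V1 C1 -> decomposable V2 C2 ->
    ~~ (V1 \subset V2) -> ~~ (V2 \subset V1) ->
    clique V1 C1 (V1 :&: V2) -> clique V2 C2 (V1 :&: V2) ->
    decomposable (V1 :|: V2) (C1 :|: C2)
| Decomposable_simplicial V C D :
    decomposable V C -> simplicial_subclutter V C D -> decomposable V D.

End Clutters.

Section Ideals.

Variables (R : comNzRingType).
Implicit Types (I : R -> Prop) (s : seq R).

Definition ideal_gen s : R -> Prop :=
  fun p => exists c : 'I_(size s) -> R, p = \sum_(i < size s) c i * s`_i.

Definition same_ideal (I J : R -> Prop) : Prop := forall p, I p <-> J p.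

Definition colon I (u : R) : R -> Prop := fun p => I (p * u).

Definition minimal_generators I s : Prop :=
  same_ideal I (ideal_gen s) /\
  forall s', subseq s' s -> same_ideal I (ideal_gen s') -> s' = s.

End Ideals.

Section LinearQuotients.

Variables (K : fieldType) (n : nat).

(* For a homogeneous ideal, "minimal generators" means, as usual in the graded *)
(* setting, an irredundant system of homogeneous generators.                   *)
Definition has_linear_quotients (I : {mpoly K[n]} -> Prop) : Prop :=
  exists us : seq {mpoly K[n]},
    [/\ forall u, u \in us -> exists k : nat, u \is k.-homog,
        minimal_generators I us
      & forall i : nat, (0 < i < size us)%N ->
          exists ls : seq {mpoly K[n]},
            (forall l, l \in ls -> l \is 1.-homog) /\
            same_ideal (colon (ideal_gen (take i us)) us`_i) (ideal_gen ls)].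

Definition xmon (T : {set 'I_n}) : {mpoly K[n]} := \prod_(i in T) 'X_i.

Definition circuit_ideal (C : {set {set 'I_n}}) : {mpoly K[n]} -> Prop :=
  ideal_gen [seq xmon T | T <- enum C].

End LinearQuotients.

Arguments circuit_ideal K {n} C _.

(* Main.v *)
Require Import Defs.
From mathcomp Require Import all_boot all_order all_algebra.
From mathcomp Require Import mpoly.

(** The ideal of the complement is generated by squarefree monomials of one
    degree d, and for such an ideal linear quotients are a purely combinatorial
    matter.  The colon ideal (x_G : G earlier) : x_F is generated by the
    monomials of the sets G \ F, so it is generated by variables as soon as
    every G \ F, for G earlier than F, contains a singleton H \ F with H also
    earlier than F ([colon_xmon]).  Since all generators have the same degree,
    none is redundant ([uniform_xmon_minimal]).  It remains to order the missing
    d-sets of a decomposable clutter in such a way, by induction on its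
    construction.

    Two orders can be concatenated when every set F of the second family and
    every G of the first one admit a suitable H in the first family
    ([linear_quotient_orderableU]); this is how all orders below are assembled.

    - A complete clutter misses nothing.

    - For a union C1, C2 on V1, V2, the intersection of V1 and V2 being a clique
      on both sides, a missing set is either missing from C1, or missing from
      C2, or meets both V1 \ V2 and V2 \ V1, and these cases exclude one another
      ([complement_union]).  The sets of the last kind come first.  They satisfy
      the basis exchange axiom of matroids, and exchange makes the
      colexicographic order work ([exchange_linear_quotient_orderable]).  A set
      F missing from C1 is not contained in the clique, so it has an element of
      V1 \ V2; if an earlier G contains some v in V2 \ V1, trading for v an
      element of F other than the chosen one gives an earlier set H with
      H \ F = {v} ([transversal_colon_variable]).  Sets missing from C2 are
      treated alike.

    - Removing from C a family A of circuits through a simplicial e adds A to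
      the missing sets, and A is put at the end.  If G was missing from C, then
      G is not contained in the closed neighbourhood of e, which is a clique
      containing F = e + c; any v of G outside this neighbourhood gives the set
      H = e + v, missing from C, with H \ F = {v}.  Two members of A differ by the
      exchange of one vertex, so among themselves any order works
      ([orderable_complement_simplicial]). *)
Set Implicit Arguments.
Unset Strict Implicit.
Unset Printing Implicit Defensive.

(** * Orders of set families giving linear quotients *)
Section LinearOrders.

Variable T : finType.
Implicit Types (F G H S : {set T}) (A B : {set {set T}}) (s : seq {set T}).

(** In monomial terms: the colon (x_H) : x_F is generated by a single variable,
    and that variable lies in G.  It is then outside F, hence divides the
    generator x_(G \ F) of (x_G) : x_F. *)
Definition colon_variable F G H : Prop :=
  exists2 v, v \in G & H :\: F = [set v].

Definition linear_quotient_order s : Prop :=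
  forall i, i < size s -> forall G, G \in take i s ->
    exists2 H, H \in take i s & colon_variable (nth set0 s i) G H.

Definition linear_quotient_orderable A : Prop :=
  exists s, [/\ uniq s, s =i A & linear_quotient_order s].

Lemma linear_quotient_orderable0 : linear_quotient_orderable set0.
Proof. by exists [::]; split=> // F; rewrite inE. Qed.

(** Members of the second family are tested against the first family by the last
    hypothesis and against each other by their own order. *)
Lemma linear_quotient_orderableU A B :
  [disjoint A & B] -> linear_quotient_orderable A -> linear_quotient_orderable B ->
  (forall F G, F \in B -> G \in A ->
     exists2 H, H \in A & colon_variable F G H) ->
  linear_quotient_orderable (A :|: B).
Proof.
move=> dAB [s [uS sA lS]] [t [uT tB lT]] AB; exists (s ++ t); split.
- rewrite cat_uniq uS uT andbT /=; apply/hasPn=> F.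
  by rewrite tB sA => FB; rewrite (disjointFl dAB FB).
- by move=> F; rewrite mem_cat sA tB inE.
move=> i; rewrite size_cat take_cat nth_cat.
case: (ltnP i (size s)) => [lti _|lei lti].
  exact: lS.
have lti' : i - size s < size t by rewrite ltn_subLR.
move=> G; rewrite mem_cat => /orP[Gs|Gt].
  have [||H HA FGH] := AB (nth set0 t (i - size s)) G.
  - by rewrite -tB mem_nth.
  - by rewrite -sA.
  by exists H; rewrite // mem_cat sA HA.
by have [H Ht FGH] := lT _ lti' _ Gt; exists H; rewrite // mem_cat Ht orbT.
Qed.

(** Any order works here, with H = G, since G \ F is already a singleton. *)
Lemma adjacent_linear_quotient_orderable A :
  (forall F G, F \in A -> G \in A -> F != G -> exists v, G :\: F = [set v]) ->
  linear_quotient_orderable A.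
Proof.
move=> adj; exists (enum A); split=> [||i lti G Gi]; first exact: enum_uniq.
  by move=> F; rewrite mem_enum.
have FA : nth set0 (enum A) i \in A by rewrite -mem_enum mem_nth.
have [||v GFv] := adj _ G FA.
- by rewrite -mem_enum (mem_take Gi).
- apply: contraTneq Gi => <-.
  by rewrite in_take ?mem_nth // index_uniq ?ltnn // enum_uniq.
exists G => //; exists v => //.
by have /setDP[] : v \in G :\: nth set0 (enum A) i by rewrite GFv inE.
Qed.

(** Comparing these numbers compares the sets colexicographically: the weight is
    the integer whose binary digits are the indicator of the set. *)
Definition colex_weight S : nat := \sum_(i in S) 2 ^ enum_rank i.

Lemma colex_weight_lt k S :
  (forall i, i \in S -> enum_rank i < k) -> colex_weight S < 2 ^ k.
Proof.
elim: k S => [|k IHk] S ltS.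
  by rewrite /colex_weight big1 // => i /ltS.
case: (pickP (fun i => (i \in S) && (enum_rank i == k :> nat))) => [y|noy].
  case/andP=> yS /eqP yk; rewrite /colex_weight (big_setD1 y) //= yk.
  rewrite expnS mul2n -addnn ltn_add2l; apply: IHk => i.
  rewrite !inE => /andP[iy /ltS]; rewrite ltnS leq_eqVlt -yk => /orP[|//].
  by move=> /eqP/val_inj/enum_rank_inj eq_iy; rewrite eq_iy eqxx in iy.
apply: (@leq_trans (2 ^ k)); last by rewrite leq_pexp2l.
apply: IHk => i iS; have := ltS i iS.
by rewrite ltnS leq_eqVlt => /orP[ik|//]; have := noy i; rewrite iS ik.
Qed.

(** The largest element of the symmetric difference decides the comparison, its
    power of two exceeding the weight of any set of smaller elements. *)
Lemma colex_weight_max_diff F G :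
  F != G -> colex_weight G <= colex_weight F ->
  exists2 x, x \in F :\: G &
    forall v, v \in G :\: F -> enum_rank v < enum_rank x.
Proof.
move=> neqFG leGF; set D := (F :\: G) :|: (G :\: F).
have [y yD] : exists y, y \in D.
  apply/set0Pn; apply: contra neqFG; rewrite setU_eq0 !setD_eq0.
  by rewrite -eqEsubset.
have [x xD maxx] := @arg_maxnP T y (mem D) (fun i => enum_rank i) yD.
have lt_x v : v \in D -> v != x -> enum_rank v < enum_rank x.
  move=> vD nvx; rewrite ltn_neqAle; apply/andP; split; last exact: maxx.
  by apply: contra nvx => /eqP/val_inj/enum_rank_inj ->.
case/setUP: (xD) => xFG.
  exists x => // v vGF; apply: lt_x; first by rewrite inE vGF orbT.
  apply: contraTneq vGF => ->; move: xFG; rewrite !inE.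
  by case/andP=> /negPf-> _; rewrite andbF.
suff : colex_weight F < colex_weight G by rewrite ltnNge leGF.
rewrite /colex_weight (big_setID G) [X in _ < X](big_setID F) /=.
rewrite setIC ltn_add2l; apply: (@leq_trans (2 ^ enum_rank x)).
  apply: colex_weight_lt => v vFG; apply: lt_x; first by rewrite inE vFG.
  apply: contraTneq vFG => ->; move: xFG; rewrite !inE.
  by case/andP=> /negPf-> _; rewrite andbF.
by rewrite (big_setD1 x) //= leq_addr.
Qed.

(** The hypothesis is the basis exchange axiom, so that this is the fact that a
    matroid has linear quotients.  Order colexicographically, let x be the
    largest element in which F and an earlier G differ, which lies in F, and
    exchange x for some v of G; as v is below x, the new set precedes F. *)
Lemma exchange_linear_quotient_orderable A :
  (forall F G x, F \in A -> G \in A -> x \in F :\: G ->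
     exists2 v, v \in G :\: F & v |: (F :\ x) \in A) ->
  linear_quotient_orderable A.
Proof.
move=> exch; pose le_w := relpre colex_weight leq.
have tot_w : total le_w by move=> F G; apply: leq_total.
have refl_w : reflexive le_w by move=> F; apply: leqnn.
have trans_w : transitive le_w by move=> G F H; apply: leq_trans.
pose s := sort le_w (enum A).
have sA : s =i A by move=> F; rewrite mem_sort mem_enum.
have uS : uniq s by rewrite sort_uniq enum_uniq.
have sortS : sorted le_w s by apply: sort_sorted.
exists s; split=> // i lti G Gi; set F := nth set0 s i.
have Fs : F \in s by apply: mem_nth.
have Gs : G \in s by apply: mem_take Gi.
have idxF : index F s = i by rewrite index_uniq.
have ltG : index G s < i by rewrite -in_take.
have neqFG : F != G by apply: contraTneq ltG => <-; rewrite idxF ltnn.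
have leGF : colex_weight G <= colex_weight F.
  apply: (sorted_leq_index trans_w refl_w sortS _ _ Gs Fs).
  by rewrite idxF ltnW.
have [x xFG ltx] := colex_weight_max_diff neqFG leGF.
have [||v vGF HA] := exch F G x _ _ xFG; rewrite -?sA //.
have ltv := ltx v vGF.
move: xFG vGF; rewrite !inE => /andP[xG xF] /andP[vF vG].
exists (v |: F :\ x); last first.
  exists v => //; apply/setP=> z; rewrite !inE.
  by case: eqP => [->|_] /=; [rewrite vF | case: (z \in F); rewrite ?andbF].
have Hs : v |: F :\ x \in s by rewrite sA.
rewrite in_take // ltnNge -idxF; apply/negP=> leFH.
have : le_w F (v |: F :\ x).
  exact: (sorted_leq_index trans_w refl_w sortS _ _ Fs Hs leFH).
rewrite /le_w /= /colex_weight big_setU1 ?inE ?(negPf vF) ?andbF //=.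
by rewrite (big_setD1 x xF) /= leq_add2r leq_exp2l // leqNgt ltv.
Qed.

End LinearOrders.

(** * Missing sets of decomposable clutters *)
Section DecomposableClutters.

Variables (T : finType) (d : nat).
Hypothesis d_gt0 : 0 < d.
Implicit Types (U V F G H e : {set T}) (C D A : {set {set T}}).

(** For disjoint nonempty U1 and U2 inside V these are, if there are any, the
    bases of a matroid: its dual is a truncation of the direct sum of the uniform
    matroids of rank |U1| - 1 on U1, |U2| - 1 on U2 and full rank on the other
    points of V. *)
Definition transversal_sets V U1 U2 : {set {set T}} :=
  [set F in complete_clutter d V | (F :&: U1 != set0) && (F :&: U2 != set0)].

Lemma complete_clutter_exchange V F G v x :
  F \in complete_clutter d V -> G \in complete_clutter d V ->
  x \in F -> v \in G :\: F -> v |: F :\ x \in complete_clutter d V.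
Proof.
rewrite !inE => /andP[FV /eqP <-] /andP[GV _] xF /andP[vF vG].
rewrite subUset sub1set (subsetP GV) // (subset_trans (subsetDl _ _)) //=.
by rewrite cardsU1 !inE (negPf vF) andbF (cardsD1 x F) xF.
Qed.

Lemma transversal_setsC V U1 U2 :
  transversal_sets V U1 U2 = transversal_sets V U2 U1.
Proof. by apply/setP=> F; rewrite !inE; congr (_ && _); apply: andbC. Qed.

(** If x is the only point of F in U1, the exchange must bring in a point of U1:
    take any from G.  Nothing is lost in U2, as x is not there. *)
Lemma transversal_exchange_last V U1 U2 F G x :
  [disjoint U1 & U2] -> F \in transversal_sets V U1 U2 ->
  G \in transversal_sets V U1 U2 -> x \in F :\: G -> F :&: U1 \subset [set x] ->
  exists2 v, v \in G :\: F & v |: (F :\ x) \in transversal_sets V U1 U2.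
Proof.
move=> dU; rewrite ![_ \in transversal_sets _ _ _]inE.
case/and3P=> FV FU1 /set0Pn[y] /setIP[yF yU2].
case/and3P=> GV /set0Pn[v] /setIP[vG vU1] _ /setDP[xF xG] FU1x.
have xU1 : x \in U1.
  by have /set0Pn[z zF] := FU1; have /set1P <- := subsetP FU1x z zF; case/setIP: zF.
have vGF : v \in G :\: F.
  rewrite inE vG andbT; apply: contra xG => vF.
  by have /set1P <- : v \in [set x] by rewrite (subsetP FU1x) // inE vF.
exists v => //; rewrite inE (complete_clutter_exchange FV GV) //=.
apply/andP; split; apply/set0Pn; first by exists v; rewrite !inE eqxx.
exists y; rewrite !inE yF yU2 !andbT; apply/orP; right.
by apply: contraTneq yU2 => ->; rewrite (disjointFr dU).
Qed.

Lemma transversal_linear_quotient_orderable V U1 U2 :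
  [disjoint U1 & U2] -> linear_quotient_orderable (transversal_sets V U1 U2).
Proof.
move=> dU; apply: exchange_linear_quotient_orderable => F G x FA GA xFG.
case: (boolP (F :&: U1 \subset [set x])) => [|nF1].
  exact: transversal_exchange_last.
case: (boolP (F :&: U2 \subset [set x])) => [F2|nF2].
  rewrite transversal_setsC; apply: transversal_exchange_last => //.
  - by rewrite disjoint_sym.
  - by rewrite transversal_setsC.
  - by rewrite transversal_setsC.
move: FA GA; rewrite ![_ \in transversal_sets _ _ _]inE => /andP[FV _] /andP[GV _].
have [xF xG] := setDP xFG.
have [v vGF] : exists v, v \in G :\: F.
  apply/set0Pn; rewrite setD_eq0; apply: contra xG => GF.
  suff -> : G = F by [].
  apply/eqP; rewrite eqEcard GF; move: FV GV.
  by rewrite !inE => /andP[_ /eqP->] /andP[_ /eqP->] /=.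
exists v => //; rewrite inE (complete_clutter_exchange FV GV) //=.
have meet U : ~~ (F :&: U \subset [set x]) -> (v |: F :\ x) :&: U != set0.
  case/subsetPn=> z /setIP[zF zU]; rewrite inE => zx; apply/set0Pn; exists z.
  by rewrite !inE zF zU zx orbT.
by rewrite !meet.
Qed.

(** Since d > 1, some x in F other than a chosen point of F in U1 can be given up
    for v, and the result still meets U1. *)
Lemma transversal_colon_variable V U1 U2 F G v :
  1 < d -> [disjoint U1 & U2] ->
  F \in complete_clutter d V -> F :&: U1 != set0 -> G \in complete_clutter d V ->
  v \in G :\: F -> v \in U2 ->
  exists2 H, H \in transversal_sets V U1 U2 & colon_variable F G H.
Proof.
move=> d_gt1 dU FV /set0Pn[a] /setIP[aF aU1] GV vGF vU2.
have [x] : exists x, x \in F :\ a.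
  apply/set0Pn; rewrite -card_gt0; move: FV; rewrite inE (cardsD1 a F) aF.
  by case/andP=> _ /eqP dE; rewrite -dE in d_gt1.
case/setD1P=> xa xF; exists (v |: F :\ x); last first.
  have [vG vF] := setDP vGF; exists v => //; apply/setP=> z; rewrite !inE.
  by case: eqP => [->|_] /=; [rewrite vF | case: (z \in F); rewrite ?andbF].
rewrite inE (complete_clutter_exchange FV GV) //=.
apply/andP; split; apply/set0Pn; last by exists v; rewrite !inE eqxx.
by exists a; rewrite !inE aF aU1 [a == x]eq_sym xa orbT.
Qed.

Lemma complement_complete V : complement d V (complete_clutter d V) = set0.
Proof. by apply/setP=> F; rewrite !inE; case: (F \subset V); case: eqP. Qed.

Lemma cliqueP V C F : clique d V C F ->
  forall G, G \subset F -> #|G| = d -> G \in C.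
Proof.
case=> _ [ltFd G GF dG|]; last by [].
by have := subset_leq_card GF; rewrite dG leqNgt ltFd.
Qed.

(** The cliques ensure that a d-set inside both V1 and V2 is a circuit on both
    sides, so a set missing from one side is not a circuit of the other. *)
Lemma complement_union V1 C1 V2 C2 :
  C1 \subset complete_clutter d V1 -> C2 \subset complete_clutter d V2 ->
  clique d V1 C1 (V1 :&: V2) -> clique d V2 C2 (V1 :&: V2) ->
  complement d (V1 :|: V2) (C1 :|: C2) =
  transversal_sets (V1 :|: V2) (V1 :\: V2) (V2 :\: V1)
    :|: complement d V1 C1 :|: complement d V2 C2.
Proof.
move=> sC1 sC2 clq1 clq2; apply/setP=> F; rewrite !inE.
have outE U W : F \subset U :|: W -> (F :&: (U :\: W) == set0) = (F \subset W).
  move=> FUW; rewrite setIDA setD_eq0; apply/idP/idP => [|FW].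
    move=> FUsW; apply/subsetP=> z zF; have := subsetP FUW z zF.
    by case/setUP=> // zU; rewrite (subsetP FUsW) // inE zF.
  by rewrite subIset // FW.
case: (boolP (#|F| == d)) => [/eqP dF|_]; last by rewrite /= !andbF.
rewrite !andbT /=.
case: (boolP (F \subset V1 :|: V2)) => [FV|nFV] /=; last first.
  case: (boolP (F \subset V1)) => [FV1|_].
    by rewrite (subset_trans FV1 (subsetUl _ _)) in nFV.
  case: (boolP (F \subset V2)) => [FV2|_ //].
  by rewrite (subset_trans FV2 (subsetUr _ _)) in nFV.
rewrite (outE V1) // (outE V2) 1?setUC //.
have C1P : F \in C1 -> F \subset V1 by move/(subsetP sC1); rewrite inE => /andP[].
have C2P : F \in C2 -> F \subset V2 by move/(subsetP sC2); rewrite inE => /andP[].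
have C12 : F \subset V1 -> F \subset V2 -> (F \in C1) && (F \in C2).
  by move=> F1 F2; rewrite (cliqueP clq1) ?(cliqueP clq2) // subsetI F1.
case: (boolP (F \subset V1)) C1P C12 => F1; case: (boolP (F \subset V2)) C2P => F2;
  case: (F \in C1); case: (F \in C2) => // P1 P2 P3;
  by [have := P1 isT | have := P2 isT | have := P3 isT isT].
Qed.

Lemma orderable_complement_union V1 C1 V2 C2 :
  C1 \subset complete_clutter d V1 -> C2 \subset complete_clutter d V2 ->
  clique d V1 C1 (V1 :&: V2) -> clique d V2 C2 (V1 :&: V2) ->
  linear_quotient_orderable (complement d V1 C1) ->
  linear_quotient_orderable (complement d V2 C2) ->
  linear_quotient_orderable (complement d (V1 :|: V2) (C1 :|: C2)).
Proof.
move=> sC1 sC2 clq1 clq2 ord1 ord2; rewrite complement_union //.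
set V := V1 :|: V2; set U1 := V1 :\: V2; set U2 := V2 :\: V1.
have dU : [disjoint U1 & U2].
  rewrite -setI_eq0; apply/eqP/setP=> z; rewrite !inE.
  by case: (z \in V1); rewrite ?andbF.
have out1 F : F \in complement d V1 C1 -> F :&: U1 != set0 /\ F :&: U2 = set0.
  rewrite inE => /and3P[F1 /eqP dF nF]; split.
    rewrite setIDA (setIidPl F1) setD_eq0; apply: contra nF => F2.
    by rewrite (cliqueP clq1) // subsetI F1.
  apply/setP=> z; rewrite !inE; case: (boolP (z \in F)) => //= zF.
  by rewrite (subsetP F1).
have out2 F : F \in complement d V2 C2 -> F :&: U2 != set0 /\ F :&: U1 = set0.
  rewrite inE => /and3P[F2 /eqP dF nF]; split.
    rewrite setIDA (setIidPl F2) setD_eq0; apply: contra nF => F1.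
    by rewrite (cliqueP clq2) // subsetI F1.
  apply/setP=> z; rewrite !inE; case: (boolP (z \in F)) => //= zF.
  by rewrite (subsetP F2).
have in1 F : F \in complement d V1 C1 -> F \in complete_clutter d V.
  by rewrite !inE => /and3P[F1 -> _]; rewrite (subset_trans F1) ?subsetUl.
have in2 F : F \in complement d V2 C2 -> F \in complete_clutter d V.
  by rewrite !inE => /and3P[F2 -> _]; rewrite (subset_trans F2) ?subsetUr.
have inT F : F \in transversal_sets V U1 U2 ->
    [/\ F \in complete_clutter d V, F :&: U1 != set0, F :&: U2 != set0 & 1 < d].
  rewrite inE => /and3P[FV FU1 FU2]; split=> //.
  have [[a aFU] [b bFU]] := (set0Pn _ FU1, set0Pn _ FU2).
  have [[aF aU] [bF bU]] := (setIP aFU, setIP bFU).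
  have ab : a != b by apply: contraTneq aU => ->; rewrite (disjointFl dU).
  move: FV; rewrite inE => /andP[_ /eqP <-].
  by rewrite (cardsD1 a) aF (cardsD1 b) !inE bF eq_sym ab.
have meetD F G U : F :&: U = set0 -> G :&: U != set0 ->
    exists2 v, v \in G :\: F & v \in U.
  move=> FU /set0Pn[v] /setIP[vG vU]; exists v; rewrite // inE vG andbT.
  by apply/negP=> vF; have := in_set0 v; rewrite -FU inE vF vU.
have cross1 F G : F \in complement d V1 C1 -> G \in complete_clutter d V ->
    1 < d -> G :&: U2 != set0 ->
    exists2 H, H \in transversal_sets V U1 U2 & colon_variable F G H.
  move=> FC GV d_gt1 GU; have [FU1 FU2] := out1 F FC.
  have [v vGF vU] := meetD _ _ _ FU2 GU.
  exact: (transversal_colon_variable d_gt1 dU (in1 F FC) FU1 GV vGF vU).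
have cross2 F G : F \in complement d V2 C2 -> G \in complete_clutter d V ->
    1 < d -> G :&: U1 != set0 ->
    exists2 H, H \in transversal_sets V U1 U2 & colon_variable F G H.
  move=> FC GV d_gt1 GU; have [FU2 FU1] := out2 F FC.
  have [v vGF vU] := meetD _ _ _ FU1 GU; rewrite transversal_setsC.
  rewrite disjoint_sym in dU.
  exact: (transversal_colon_variable d_gt1 dU (in2 F FC) FU2 GV vGF vU).
apply: linear_quotient_orderableU => //; last first.
- move=> F G FC /setUP[GT|GC].
    have [GV GU1 _ d_gt1] := inT G GT.
    have [H HT FGH] := cross2 F G FC GV d_gt1 GU1.
    by exists H; rewrite // inE HT.
  have [GU1 GU2] := out1 G GC; have [FU2 FU1] := out2 F FC.
  case: (ltnP 1 d) => [d_gt1|d_le1].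
    have [H HT FGH] := cross2 F G FC (in1 G GC) d_gt1 GU1.
    by exists H; rewrite // inE HT.
  (* For d = 1 no set meets both sides, but G is a single point outside F. *)
  exists G; first by rewrite inE GC orbT.
  have [v] := meetD _ _ _ FU1 GU1; case/setDP=> vG vF _.
  have /cards1P[w GE] : #|G| == 1.
    move: (in1 G GC); rewrite inE => /andP[_ /eqP ->].
    by rewrite eqn_leq d_le1.
  exists v => //; move: vG; rewrite GE => /set1P <-.
  by apply/setDidPl; rewrite disjoints1.
- apply: linear_quotient_orderableU => //; first 1 last.
  + exact: transversal_linear_quotient_orderable.
  + move=> F G FC GT; have [GV _ GU2 d_gt1] := inT G GT.
    exact: cross1 FC GV d_gt1 GU2.
  rewrite -setI_eq0; apply/eqP/setP=> F; rewrite [LHS]inE in_set0.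
  apply/negP=> /andP[/inT[_ _ FU2 _] /out1[_ FU2']].
  by rewrite FU2' eqxx in FU2.
- rewrite -setI_eq0; apply/eqP/setP=> F; rewrite [LHS]inE in_set0.
  apply/negP=> /andP[+ /out2[FU2 FU1]].
  case/setUP=> [/inT[_ FU1' _ _]|/out1[FU1' _]].
    by rewrite FU1 eqxx in FU1'.
  by rewrite FU1 eqxx in FU1'.
Qed.

(** The closed neighbourhood of e is a clique containing every circuit through e,
    whereas no d-set outside C fits in it; this provides the vertex v that yields
    the variable. *)
Lemma orderable_complement_simplicial V C A e :
  C \subset complete_clutter d V -> e \subset V -> #|e| = d.-1 ->
  simplicial d V C e -> (forall F, F \in A -> e \subset F) ->
  linear_quotient_orderable (complement d V C) ->
  linear_quotient_orderable (complement d V (C :\: A)).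
Proof.
move=> sC eV de simp sA ordC.
have -> : complement d V (C :\: A) = complement d V C :|: (C :&: A).
  apply/setP=> F; rewrite !inE.
  have := subsetP sC F; rewrite !inE.
  by case: (F \in C); case: (F \in A); rewrite /= ?andbF ?andbT ?orbF // => ->.
have addc F : F \in C :&: A -> exists c, [/\ c \notin e, c \in V & F = c |: e].
  case/setIP=> FC /sA eF; have := subsetP sC F FC; rewrite inE => /andP[FV /eqP dF].
  have /cards1P[c FeE] : #|F :\: e| == 1.
    by rewrite cardsD (setIidPr eF) dF de -{1}(prednK d_gt0) subSnn.
  have cFe : c \in F :\: e by rewrite FeE inE.
  case/setDP: cFe => cF ce; exists c; split=> //; first exact: (subsetP FV).
  by rewrite -FeE setUC -{1}(setIidPr eF) setID.
apply: linear_quotient_orderableU => //.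
- rewrite -setI_eq0; apply/eqP/setP=> F; rewrite !inE.
  by case: (F \in C); rewrite ?andbF.
- apply: adjacent_linear_quotient_orderable => F G FA GA neqFG.
  have [[a [ae _ FE]] [c [ce _ GE]]] := (addc F FA, addc G GA).
  exists c; rewrite FE GE; apply/setP=> z; rewrite !inE.
  have ca : c != a by apply: contraNneq neqFG => eq_ca; rewrite FE GE eq_ca.
  case: (eqVneq z c) => [->|] /=; first by rewrite (negPf ca) ce.
  by case: (z \in e); rewrite ?orbT ?andbF.
move=> F G FA; rewrite inE => /and3P[GV /eqP dG nG].
have [c [ce cV FE]] := addc F FA.
have FC : F \in C by case/setIP: FA.
have /subsetPn[v vG vN] : ~~ (G \subset closed_nbh V C e).
  by apply: contra nG => GN; apply: (cliqueP simp).
move: vN; rewrite !inE negb_or (subsetP GV) //= setUC => /andP[ve nve].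
exists (v |: e).
  rewrite inE nve andbT subUset sub1set (subsetP GV) // eV cardsU1 ve de /=.
  by rewrite add1n prednK.
exists v => //; apply/setP=> z; rewrite FE !inE.
case: (eqVneq z v) => [->|] /=; last by case: (z \in e); rewrite ?orbT ?andbF.
by rewrite (negPf ve) orbF andbT; apply: contraNneq nve => ->; rewrite -FE.
Qed.

Lemma decomposable_orderable_complement V C :
  decomposable d V C ->
  C \subset complete_clutter d V /\ linear_quotient_orderable (complement d V C).
Proof.
elim=> {V C} [V|V1 C1 V2 C2 _ [sC1 ord1] _ [sC2 ord2] _ _ clq1 clq2|].
- by rewrite complement_complete; split=> //; apply: linear_quotient_orderable0.
- split; last exact: orderable_complement_union.
  apply/subsetP=> F /setUP[/(subsetP sC1)|/(subsetP sC2)];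
    rewrite !inE => /andP[FV ->]; rewrite andbT;
    by rewrite (subset_trans FV) ?subsetUl ?subsetUr.
move=> V C D _ [sC ordC] [_ [t [e [A [He HA Hs ->]]]]].
set B := foldl _ _ _.
suff removed k : k <= t ->
    foldl (fun B X => B :\: X) C (take k A) \subset complete_clutter d V /\
    linear_quotient_orderable
      (complement d V (foldl (fun B X => B :\: X) C (take k A))).
  by have := removed t (leqnn t); rewrite take_oversize // size_tuple.
elim: k => [|k IHk] ltk; first by rewrite take0.
have [sB ordB] := IHk (ltnW ltk); pose i := Ordinal ltk.
rewrite (take_nth set0) ?size_tuple // -cats1 foldl_cat /=.
rewrite -(tnth_nth set0 A i); split; first exact: subset_trans (subsetDl _ _) sB.
have [eV de] := He i.
apply: (orderable_complement_simplicial sB eV de (Hs i)) => // F FA.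
by have := subsetP (HA i) F FA; rewrite inE => /andP[].
Qed.

End DecomposableClutters.

(** * Ideals given by generators *)
Import GRing.Theory.
Local Open Scope ring_scope.

Section GeneratedIdeals.

Variable R : comNzRingType.
Implicit Types (p q u : R) (s t : seq R).

Lemma ideal_gen0 s : ideal_gen s 0.
Proof. by exists (fun=> 0); rewrite big1 // => i _; rewrite mul0r. Qed.

Lemma ideal_genD s p q : ideal_gen s p -> ideal_gen s q -> ideal_gen s (p + q).
Proof.
move=> [a ->] [b ->]; exists (fun i => a i + b i).
by rewrite -big_split; apply: eq_bigr => i _; rewrite mulrDl.
Qed.

Lemma ideal_genM s p q : ideal_gen s q -> ideal_gen s (p * q).
Proof.
move=> [a ->]; exists (fun i => p * a i).
by rewrite mulr_sumr; apply: eq_bigr => i _; rewrite mulrA.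
Qed.

Lemma ideal_gen_sum s (I : Type) (r : seq I) (P : pred I) (f : I -> R) :
  (forall i, P i -> ideal_gen s (f i)) -> ideal_gen s (\sum_(i <- r | P i) f i).
Proof.
by move=> sf; apply: big_ind; [apply: ideal_gen0 | apply: ideal_genD | ].
Qed.

Lemma mem_ideal_gen s u : u \in s -> ideal_gen s u.
Proof.
move=> us; have lt_u : (index u s < size s)%N by rewrite index_mem.
exists (fun i => (i == Ordinal lt_u)%:R).
rewrite (bigD1 (Ordinal lt_u)) //= eqxx mul1r nth_index // big1 ?addr0 //.
by move=> i /negPf->; rewrite mul0r.
Qed.

Lemma ideal_gen_sub s t :
  (forall u, u \in s -> ideal_gen t u) -> forall p, ideal_gen s p -> ideal_gen t p.
Proof.
move=> st _ [c ->]; apply: ideal_gen_sum => i _; apply: ideal_genM.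
by apply: st; rewrite mem_nth.
Qed.

Lemma ideal_gen_colon s t u :
  (forall l, l \in t -> ideal_gen s (l * u)) ->
  forall p, ideal_gen t p -> colon (ideal_gen s) u p.
Proof.
move=> st _ [c ->]; rewrite /colon mulr_suml; apply: ideal_gen_sum => i _.
by rewrite -mulrA; apply/ideal_genM/st; rewrite mem_nth.
Qed.

End GeneratedIdeals.

(** * Squarefree monomial ideals *)
Section SquarefreeMonomialIdeals.

Variables (K : fieldType) (n : nat).
Implicit Types (F G : {set 'I_n}) (s : seq {set 'I_n}) (p : {mpoly K[n]}).

Lemma xmonE F : xmon K F = 'X_[mesym1 F].
Proof.
rewrite /xmon mprodXE; congr 'X_[_]; apply/mnmP=> i.
rewrite mnm_sumE mnmE; case: (boolP (i \in F)) => iF.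
  rewrite (bigD1 i) //= mnm1E eqxx big1 // => j /andP[_ /negPf ji].
  by rewrite mnm1E ji.
by rewrite big1 // => j jF; rewrite mnm1E; case: eqP iF jF => // -> /negPf->.
Qed.

Lemma xmon_homog F : xmon K F \is #|F|.-homog.
Proof. by rewrite xmonE dhomogX /= mdeg_mesym1. Qed.

Lemma lem_mesym1 F (m : 'X_{1..n}) :
  (mesym1 F <= m)%MM = [forall i in F, (0 < m i)%N].
Proof.
apply/mnm_lepP/forall_inP => [le_m i iF|pos_m i].
  by have := le_m i; rewrite mnmE iF.
by rewrite mnmE; case: (boolP (i \in F)) => // /pos_m.
Qed.

(** Monomial ideals are detected on supports: a product of a generator by any
    polynomial has only multiples of that generator in its support. *)
Lemma ideal_gen_monomials (ms : seq 'X_{1..n}) p :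
  ideal_gen [seq 'X_[m] | m <- ms] p <->
  (forall m, m \in msupp p -> exists2 m', m' \in ms & (m' <= m)%MM).
Proof.
split=> [[c ->] m /msupp_sum_le|supp_p].
  case/flatten_mapP=> i _ /msuppM_le /allpairsP[[a b] /= [_ bX ->]].
  have lti : (i < size ms)%N by rewrite -(size_map (fun m => 'X_[m] : {mpoly K[n]})).
  exists (nth 0%MM ms i); first exact: mem_nth.
  move: bX; rewrite (nth_map 0%MM) // msuppX inE => /eqP->.
  exact: lem_addl.
rewrite [p]mpolyE big_seq; apply: ideal_gen_sum => m /supp_p[m' m'ms le_m'm].
rewrite -(submK le_m'm) mpolyXD scalerAl; apply/ideal_genM/mem_ideal_gen.
exact: map_f.
Qed.

Lemma ideal_gen_xmon s p :
  ideal_gen [seq xmon K F | F <- s] p <->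
  (forall m, m \in msupp p -> exists2 F, F \in s & (mesym1 F <= m)%MM).
Proof.
rewrite (eq_map xmonE) (map_comp (fun m => 'X_[m]) (@mesym1 n)).
rewrite ideal_gen_monomials; split=> supp_p m /supp_p.
  by case=> _ /mapP[F Fs ->] leFm; exists F.
by case=> F Fs leFm; exists (mesym1 F); rewrite // map_f.
Qed.

Lemma xmon_in_ideal s F :
  ideal_gen [seq xmon K G | G <- s] (xmon K F) <-> exists2 G, G \in s & G \subset F.
Proof.
rewrite ideal_gen_xmon xmonE msuppX; split=> [/(_ _ (mem_head _ _))[G Gs leGF]|].
  exists G => //; apply/subsetP=> i iG.
  move: leGF; rewrite lem_mesym1 => /forall_inP/(_ i iG).
  by rewrite mnmE; case: (i \in F).
case=> G Gs GF m; rewrite inE => /eqP->; exists G => //.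
by rewrite lem_mesym1; apply/forall_inP=> i iG; rewrite mnmE (subsetP GF).
Qed.

(** A generator in the ideal of the others would be divisible by one of them,
    which the equality of degrees rules out. *)
Lemma uniform_xmon_minimal d s (s' : seq {mpoly K[n]}) :
  uniq s -> (forall F, F \in s -> #|F| = d) ->
  subseq s' [seq xmon K F | F <- s] ->
  same_ideal (ideal_gen [seq xmon K F | F <- s]) (ideal_gen s') ->
  s' = [seq xmon K F | F <- s].
Proof.
move=> us ds sub_s' eq_s'.
have [m sz_m s'E] := subseqP sub_s'.
move: sz_m; rewrite size_map => sz_m; rewrite -map_mask in s'E.
apply/eqP; rewrite -(size_subseq_leqif sub_s') s'E !size_map eqn_leq.
rewrite size_subseq ?mask_subseq //=.
apply: uniq_leq_size => // F Fs.
have [+ _] := eq_s' (xmon K F); rewrite s'E => in_s'.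
have /in_s' /xmon_in_ideal[G Gs GF] : ideal_gen [seq xmon K F | F <- s] (xmon K F).
  by apply: mem_ideal_gen; apply: map_f.
suff <- : G = F by [].
by apply/eqP; rewrite eqEcard GF !ds ?(mem_mask Gs) /=.
Qed.

(** If p x_F is in the ideal and m is a monomial of p, then m x_F is divisible by
    some x_G, so m is divisible by x_(G \ F), hence by the variable found in
    G \ F.  Conversely the variable of H \ F times x_F is a multiple of x_H. *)
Lemma colon_xmon s F :
  (forall G, G \in s -> exists2 H, H \in s & colon_variable F G H) ->
  exists ls : seq {mpoly K[n]}, (forall l, l \in ls -> l \is 1.-homog) /\
    same_ideal (colon (ideal_gen [seq xmon K G | G <- s]) (xmon K F))
               (ideal_gen ls).
Proof.
move=> lin_s.
pose vars := [seq v <- enum 'I_n | has (fun H => H :\: F == [set v]) s].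
have varsP v : v \in vars -> exists2 H, H \in s & H :\: F = [set v].
  by rewrite mem_filter => /andP[/hasP[H Hs /eqP HF] _]; exists H.
exists [seq xmon K [set v] | v <- vars]; split.
  by move=> l /mapP[v _ ->]; rewrite -(cards1 v) xmon_homog.
move=> p; split.
  rewrite (map_comp (xmon K (n := n)) (fun v => [set v])) ideal_gen_xmon.
  rewrite /colon ideal_gen_xmon => supp_pF m m_p.
  have [|G Gs leG] := supp_pF (mesym1 F + m)%MM.
    by rewrite xmonE (perm_mem (msuppMX _ _)); apply: map_f.
  have [H Hs [v vG HF]] := lin_s G Gs.
  have vF : v \notin F by have : v \in H :\: F by [rewrite HF inE]; case/setDP.
  exists [set v].
    apply/map_f; rewrite mem_filter mem_enum andbT.
    by apply/hasP; exists H; rewrite ?HF.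
  rewrite lem_mesym1; apply/forall_inP=> i /set1P->.
  move: leG; rewrite lem_mesym1 => /forall_inP/(_ v vG).
  by rewrite mnmDE mnmE (negPf vF).
apply: ideal_gen_colon => _ /mapP[v /varsP[H Hs HF] ->].
rewrite ideal_gen_xmon !xmonE -mpolyXD msuppX => m; rewrite inE => /eqP->.
exists H => //; rewrite lem_mesym1; apply/forall_inP=> i iH.
rewrite mnmDE !mnmE inE; case: (boolP (i \in F)) => [_|iF]; first by rewrite addn1.
have /set1P-> : i \in [set v] by rewrite -HF inE iF.
by rewrite eqxx.
Qed.

Lemma orderable_has_linear_quotients d (A : {set {set 'I_n}}) :
  (forall F, F \in A -> #|F| = d) -> linear_quotient_orderable A ->
  has_linear_quotients (circuit_ideal K A).
Proof.
move=> dA [s [us sA lin_s]].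
have eq_gens : same_ideal (circuit_ideal K A) (ideal_gen [seq xmon K F | F <- s]).
  move=> p; split; apply: ideal_gen_sub => _ /mapP[F Fs ->];
    apply/mem_ideal_gen/map_f; first by rewrite sA -mem_enum.
  by rewrite mem_enum -sA.
exists [seq xmon K F | F <- s]; split.
- move=> _ /mapP[F Fs ->]; exists d.
  by rewrite -(dA F) ?xmon_homog // -sA.
- split=> // s' sub_s' eq_s'.
  apply: (@uniform_xmon_minimal d) => // [F|p]; first by rewrite sA => /dA.
  by rewrite -(eq_gens p); apply: eq_s'.
move=> i; rewrite size_map => /andP[_ lti].
rewrite -map_take (nth_map set0) //; apply: colon_xmon; exact: lin_s.
Qed.

End SquarefreeMonomialIdeals.

Theorem theorem2p5 (K : fieldType) (n d : nat) (C : {set {set 'I_n}}) :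
  (0 < d)%N ->
  is_clutter [set: 'I_n] C ->
  uniform d C ->
  decomposable d [set: 'I_n] C ->
  has_linear_quotients (circuit_ideal K (complement d [set: 'I_n] C)).
Proof.
move=> d_gt0 _ _ decC; apply: (@orderable_has_linear_quotients _ _ d).
  by move=> F; rewrite inE => /and3P[_ /eqP].
by have [] := decomposable_orderable_complement d_gt0 decC.
Qed.
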